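(* Web functions $f(x_1,\dots,x_n)$ of hyperplanar webs in $\mathbb{R}^n$ have the form $$f=u_0\bigl(x_n+\Psi_{n-1}(f)\,x_{n-1}+\cdots+\Psi_1(f)\,x_1\bigr),$$ where $u_0(x_n)$ are initial conditions, when $x_1=\cdots=x_{n-1}=0$, and $\Psi_s$ ($s=1,\dots,n-1$) are arbitrary nonvanishing functions.
   Context: $\mathbb{R}^n$ is endowed with a flat linear connection, and $x_1,\dots,x_n$ are coordinates in which its Christoffel symbols vanish. A $d$-web of hypersurfaces ($d\ge n+1$) is given locally by web functions $f_\alpha(x_1,\dots,x_n)$, $\alpha=1,\dots,d$: its $d$ foliations are formed by the level sets of these functions. The web is hyperplanar if the leaves of all its foliations are (pieces of) hyperplanes in the coordinates $x_1,\dots,x_n$, i.e., are totally geodesic for the flat connection. The displayed formula is an implicit equation for $f$, in which $u_0$ and the $\Psi_s$ are functions of one variable.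
   Formalization: All partial derivatives of the web function f are assumed nonzero (otherwise f = x_1 is a counterexample), and in the converse u_0' is assumed nonzero (a constant u_0 gives no web function); all functions are smooth and the claim is local near points of the x_n-axis. *)

(* Defs.v *)
From HB Require Import structures.
From mathcomp Require Import all_boot all_order all_algebra.
From mathcomp Require Import all_classical all_reals all_analysis.

Set Implicit Arguments.
Unset Strict Implicit.
Unset Printing Implicit Defensive.

Import Order.TTheory GRing.Theory Num.Theory.
Import numFieldNormedType.Exports.

Local Open Scope classical_set_scope.
Local Open Scope ring_scope.

(* C^k regularity on [U], meant for [U] open and [V] finite-dimensional: [V] is
   either [R] or ['rV[R]_n].  There, a differentiable function is C^(k+1) as
   soon as all its directional derivatives are C^k. *)
Fixpoint Ck_on (R : realType) (V : normedModType R) (k : nat) (U : set V)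
    (f : V -> R) : Prop :=
  match k with
  | 0 => forall x, U x -> {for x, continuous f}
  | k'.+1 => (forall x, U x -> differentiable f x) /\
             (forall v : V, Ck_on k' U ('D_v f))
  end.

Definition smooth_on (R : realType) (V : normedModType R) (U : set V)
    (f : V -> R) : Prop :=
  forall k, Ck_on k U f.

Definition partial (R : realType) (n : nat) (i : 'I_n) (f : 'rV[R]_n -> R)
    (x : 'rV[R]_n) : R :=
  'D_(delta_mx 0 i) f x.

(* A d-web on [U]: [d] foliations by hypersurfaces in general position, i.e. any
   [n] of the [d] covectors d(F a) at a point of [U] are linearly independent.
   When [0 < n <= d] this forces every d(F a) to be nonzero on [U]. *)
Record is_web (R : realType) (n d : nat) (U : set 'rV[R]_n)
    (F : 'I_d -> 'rV[R]_n -> R) : Prop := IsWeb {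
  web_open : open U ;
  web_smooth : forall a, smooth_on U (F a) ;
  web_general_position : forall x, U x ->
    forall s : 'I_n -> 'I_d, injective s ->
      \matrix_(i < n, j < n) partial j (F (s i)) x \in unitmx
}.

Definition leaf (R : realType) (n : nat) (U : set 'rV[R]_n)
    (f : 'rV[R]_n -> R) (x : 'rV[R]_n) : set 'rV[R]_n :=
  connected_component (U `&` [set y | f y = f x]) x.

Definition hyperplane (R : realType) (n : nat) (a : 'rV[R]_n) (b : R) :
    set 'rV[R]_n :=
  [set y | \sum_(i < n) a 0 i * y 0 i = b].

(* "Piece of a hyperplane" means relatively open subset of an affine
   hyperplane. *)
Definition hyperplanar_foliation (R : realType) (n : nat) (U : set 'rV[R]_n)
    (f : 'rV[R]_n -> R) : Prop :=
  forall x, U x -> exists (a : 'rV[R]_n) (b : R) (O : set 'rV[R]_n),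
    [/\ a != 0, open O & leaf U f x = hyperplane a b `&` O].

Definition hyperplanar_web (R : realType) (n d : nat) (U : set 'rV[R]_n)
    (F : 'I_d -> 'rV[R]_n -> R) : Prop :=
  is_web U F /\ forall a, hyperplanar_foliation U (F a).

Definition hyperplanar_web_function (R : realType) (n d : nat)
    (U : set 'rV[R]_n) (f : 'rV[R]_n -> R) : Prop :=
  exists F : 'I_d -> 'rV[R]_n -> R,
    hyperplanar_web U F /\ exists a : 'I_d, F a = f.

(* The leaves of [f] are nowhere tangent to a coordinate direction.  Without
   this condition there is no such normal form with nonvanishing Psi_s
   (take f = x_1). *)
Definition transversal_to_coordinates (R : realType) (n : nat)
    (U : set 'rV[R]_n) (f : 'rV[R]_n -> R) : Prop :=
  forall x, U x -> forall i : 'I_n, partial i f x != 0.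

(* From here on n = m + 1: x_n is the coordinate [ord_max], and x_1, ..., x_(n-1)
   are the coordinates [widen_ord (leqnSn m) s], [s : 'I_m]. *)

Definition axis_point (R : realType) (m : nat) (t : R) : 'rV[R]_m.+1 :=
  t *: delta_mx 0 ord_max.

Definition implicit_arg (R : realType) (m : nat) (Psi : 'I_m -> R -> R)
    (c : R) (x : 'rV[R]_m.+1) : R :=
  x 0 ord_max + \sum_(s < m) Psi s c * x 0 (widen_ord (leqnSn m) s).

(* [I] and [J] are the domains of [u0] and of the [Psi s].  The condition
   u0' <> 0 says that the initial condition is that of a web function with
   nonzero partial derivative along x_n. *)
Record admissible_data (R : realType) (m : nat) (t0 : R) (I J : set R)
    (u0 : R -> R) (Psi : 'I_m -> R -> R) : Prop := AdmissibleData {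
  data_open_I : open I ;
  data_open_J : open J ;
  data_t0 : I t0 ;
  data_u0t0 : J (u0 t0) ;
  data_smooth_u0 : smooth_on I u0 ;
  data_du0 : forall t, I t -> 'D_1 u0 t != 0 ;
  data_smooth_Psi : forall s, smooth_on J (Psi s) ;
  data_Psi_neq0 : forall s c, J c -> Psi s c != 0
}.

Record solves_implicit_equation (R : realType) (m : nat)
    (V : set 'rV[R]_m.+1) (I J : set R) (u0 : R -> R) (Psi : 'I_m -> R -> R)
    (f : 'rV[R]_m.+1 -> R) : Prop := SolvesImplicitEquation {
  sol_J : forall x, V x -> J (f x) ;
  sol_I : forall x, V x -> I (implicit_arg Psi (f x) x) ;
  sol_eq : forall x, V x -> f x = u0 (implicit_arg Psi (f x) x) ;
  sol_init : forall t, V (axis_point m t) -> f (axis_point m t) = u0 t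
}.

(* Main.v *)
(* At a point y0 of the x_n-axis the leaf of f lies in its tangent hyperplane,
   which is x_n + sum_s Psi_s(c) x_s = t with c = f(y0), y0 = (0, ..., 0, t)
   and Psi_s = (d_s f / d_n f)(y0).  Being both open and closed in that
   hyperplane, the leaf fills it near y0, and near the base point these
   hyperplanes cover a neighbourhood.  Reading t off from c through the inverse
   of u0(t) = f(0, ..., 0, t) gives the implicit equation.

   Conversely, with phi_s = Psi_s o u0 the equation f = u0(T) becomes
   T = x_n + sum_s phi_s(T) x_s, whose right-hand side is 1/2-Lipschitz in T
   near the axis; hence a smooth solution exists, and by uniqueness its level
   sets are exactly the hyperplanes.  The gradient w of the solution is completed
   to a web by linear functions with covectors v(1) g, v(2) g, ..., where
   v(j) = (1, j, j^2, ...) and g is invertible with v(0) g = w: any n of the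
   v(j) are independent by Vandermonde. *)
Require Import Defs.
From HB Require Import structures.
From mathcomp Require Import all_boot all_order all_algebra.
From mathcomp Require Import all_classical all_reals all_analysis.
From mathcomp Require Import ring lra.
Import Order.TTheory GRing.Theory Num.Theory.
Import numFieldNormedType.Exports.
Local Open Scope classical_set_scope.
Local Open Scope ring_scope.

Set Implicit Arguments.
Unset Strict Implicit.
Unset Printing Implicit Defensive.

(** * Functions of class C^k *)

(** The little-o expansion of [diff_unique] is traded for an epsilon bound. Continuity of [df] is a
    premise because differentiability includes continuity of the differential. *)
Lemma is_diff_bound (R : realType) (V : normedModType R) (f : V -> R)
    (df : {linear V -> R}) (x : V) :
  continuous df ->
  (forall e, 0 < e ->
     \forall y \near x, `|f y - f x - df (y - x)| <= e * `|y - x|) ->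
  is_diff x f df.
Proof.
move=> cdf H.
have E : f \o shift x = cst (f x) + df +o_ (0 : V) id.
  apply/eqaddoP => /= e e0.
  have := H e e0; rewrite (near_shift 0) /=; apply: filterS => h /=.
  by rewrite subr0 addrK !fctE /= opprD addrA.
have Ed := diff_unique cdf E.
split=> //; apply/diff_locallyP; rewrite Ed; split=> //.
Qed.

Lemma differentiable_bound (R : realType) (V : normedModType R) (f : V -> R) (x : V) (e : R) :
  differentiable f x -> 0 < e ->
  \forall y \near x, `|f y - f x - 'd f x (y - x)| <= e * `|y - x|.
Proof.
move=> /diff_locallyP [_ /eqaddoP/(_ e) H] /H Hx.
rewrite (near_shift 0) /=; apply: filterS Hx => h /=.
by rewrite subr0 addrK !fctE /= opprD addrA.
Qed.

(** Carathéodory's criterion, asking of the factor [A] only continuity at [x]. The error is [A y]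
    times the remainder of [g], minus [(A x - A y)] times ['d g x (y - x)]: the first is small since
    [A] is bounded near [x], the second since [A] is continuous and ['d g x] is Lipschitz. *)
Lemma diff_caratheodory (R : realType) (V : normedModType R) (f g A : V -> R)
    (x : V) :
  differentiable g x -> {for x, continuous A} ->
  (\forall y \near x, f y - f x = A y * (g y - g x)) ->
  is_diff x f (A x \*: 'd g x).
Proof.
move=> dg cA fE.
apply: is_diff_bound.
  move=> v /=; apply: cvgM; first exact: cvg_cst.
  exact: (diff_continuous dg).
move=> e e0.
have [K [K0 HK]] : exists K : R, 0 < K /\ forall v, `|'d g x v| <= K * `|v|.
  have [K K0 HK] := linear_lipschitz (diff_continuous dg).
  by exists K.
(* [a] bounds [|A y|] as soon as [|A x - A y| <= 1]; each of the two error terms then receives half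
   of [e]. *)
set a := `|A x| + 1.
have a0 : 0 < a by rewrite ltr_wpDl.
have e1 : 0 < e / 2 / a by rewrite !divr_gt0.
have e2 : 0 < Num.min 1 (e / 2 / K) by rewrite lt_min ltr01 !divr_gt0.
have Hg := differentiable_bound dg e1.
move/cvgr_dist_le : cA => /(_ _ e2) HA.
near=> y.
have -> : f y - f x = A y * (g y - g x) by near: y.
have h1 : `|g y - g x - 'd g x (y - x)| <= e / 2 / a * `|y - x| by near: y.
have h2 : `|A x - A y| <= Num.min 1 (e / 2 / K) by near: y.
have -> : A y * (g y - g x) - (A x \*: 'd g x) (y - x) =
  A y * (g y - g x - 'd g x (y - x)) - (A x - A y) * 'd g x (y - x).
  rewrite /= -mulr_algl; set d := 'd g x _; rewrite /GRing.scale /=; ring.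
apply: (le_trans (ler_normB _ _)); rewrite !normrM.
move: h2; rewrite le_min => /andP[h2 h3].
have hA : `|A y| <= a.
  rewrite /a; have -> : A y = A x - (A x - A y) by ring.
  by apply: (le_trans (ler_normB _ _)); rewrite lerD2l.
have -> : e * `|y - x| = a * (e / 2 / a * `|y - x|) + e / 2 / K * (K * `|y - x|).
  by field; rewrite !gt_eqF.
by apply: lerD; apply: ler_pM.
Unshelve. all: by end_near. Qed.

Lemma near_eq_differentiable (R : realType) (V : normedModType R) (f g : V -> R) x :
  (\near x, f x = g x) -> differentiable f x -> differentiable g x.
Proof.
move=> fg df; have fgx := nbhs_singleton fg.
(* Carathéodory's criterion with the constant factor 1. *)
suff : is_diff x g (1 \*: 'd f x) by case.
apply: (@diff_caratheodory _ _ g f (fun=> 1)) => //; first exact: cst_continuous.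
by near=> y; rewrite mul1r -fgx; congr (_ - _); apply/esym; near: y.
Unshelve. all: by end_near. Qed.

Lemma CkS (R : realType) (V : normedModType R) k (U : set V) (f : V -> R) :
  Ck_on k.+1 U f -> Ck_on k U f.
Proof.
elim: k f => [|k IH] f /=.
  by move=> [df _] x Ux; exact/differentiable_continuous/df.
move=> [df dDf]; split=> // v; exact/IH/dDf.
Qed.

Lemma Ck_cst (R : realType) (V : normedModType R) k (U : set V) (c : R) :
  Ck_on k U (fun=> c).
Proof.
elim: k c => [|k IH] c /=; first by move=> x _; exact: cst_continuous.
split=> [x _|v]; first exact: differentiable_cst.
have -> : 'D_v (fun _ : V => c) = fun=> 0 by apply/funext => x; rewrite derive_cst.
exact: IH.
Qed.

(** Differentiation rules give equalities on [U] only, so the inductions below need C^k to depend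
    only on the values on [U]. Openness turns such an equality into one near each point, which
    derivatives respect. *)
Lemma Ck_eq (R : realType) (V : normedModType R) k (U : set V) (f g : V -> R) :
  open U -> (forall x, U x -> f x = g x) -> Ck_on k U f -> Ck_on k U g.
Proof.
move=> oU.
have nearU x (f' g' : V -> R) : U x -> (forall x, U x -> f' x = g' x) ->
    \near x, f' x = g' x.
  by move=> Ux fg; apply: filterS fg _; exact: open_nbhs_nbhs.
elim: k f g => [|k IH] f g fg /=.
  move=> cf x Ux; rewrite /prop_for /continuous_at -(fg x Ux).
  apply: cvg_trans (cf x Ux); apply: near_eq_cvg; exact: nearU.
move=> [df Df]; split=> [x Ux|v].
  by apply: near_eq_differentiable (df _ Ux); exact: nearU.
apply: IH (Df v) => x Ux; apply: near_eq_derive; exact: nearU.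
Qed.

Lemma CkD (R : realType) (V : normedModType R) k (U : set V) (f g : V -> R) :
  open U -> Ck_on k U f -> Ck_on k U g -> Ck_on k U (fun x => f x + g x).
Proof.
move=> oU; elim: k f g => [|k IH] f g /=.
  by move=> cf cg x Ux; apply: cvgD; [exact: cf|exact: cg].
move=> [df Df] [dg Dg]; split=> [x Ux|v].
  by apply: differentiableD; [exact: df|exact: dg].
apply: (Ck_eq oU _ (IH _ _ (Df v) (Dg v))) => x Ux.
by rewrite -deriveD //; apply: diff_derivable; [exact: df|exact: dg].
Qed.

Lemma CkM (R : realType) (V : normedModType R) k (U : set V) (f g : V -> R) :
  open U -> Ck_on k U f -> Ck_on k U g -> Ck_on k U (fun x => f x * g x).
Proof.
move=> oU; elim: k f g => [|k IH] f g.
  by move=> cf cg x Ux; apply: cvgM; [exact: cf|exact: cg].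
move=> kf kg; have [df Df] := kf; have [dg Dg] := kg; split=> [x Ux|v].
  by apply: differentiableM; [exact: df|exact: dg].
apply: (@Ck_eq _ _ _ _ (fun x => f x * 'D_v g x + g x * 'D_v f x) _ oU).
  move=> x Ux; rewrite deriveM //; apply: diff_derivable; [exact: df|exact: dg].
(* The product rule multiplies derivatives by the undifferentiated factors, whose regularity has to
   be lowered by one. *)
by apply: CkD oU _ _; apply: IH; first [exact: Df|exact: Dg|exact: CkS].
Qed.

Lemma Ck_sum (R : realType) (V : normedModType R) k (U : set V) m (f : 'I_m -> V -> R) :
  open U -> (forall s, Ck_on k U (f s)) -> Ck_on k U (fun x => \sum_(s < m) f s x).
Proof.
move=> oU; elim: m f => [|m IH] f kf.
  by apply: (@Ck_eq _ _ _ _ (fun=> 0) _ oU _ (Ck_cst _ _ _)) => x _; rewrite big_ord0.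
apply: (@Ck_eq _ _ _ _ (fun x => \sum_(s < m) f (widen_ord (leqnSn m) s) x + f ord_max x) _ oU).
  by move=> x _; rewrite big_ord_recr.
by apply: CkD => //; exact: IH.
Qed.

Lemma CkN (R : realType) (V : normedModType R) k (U : set V) (f : V -> R) :
  open U -> Ck_on k U f -> Ck_on k U (fun x => - f x).
Proof.
move=> oU kf.
apply: (@Ck_eq _ _ _ _ (fun x => -1 * f x) _ oU); first by move=> x _; rewrite mulN1r.
by apply: CkM => //; exact: Ck_cst.
Qed.

Lemma CkV (R : realType) (V : normedModType R) k (U : set V) (f : V -> R) :
  open U -> (forall x, U x -> f x != 0) -> Ck_on k U f ->
  Ck_on k U (fun x => (f x)^-1).
Proof.
move=> oU f0; elim: k => [|k IH].
  by move=> cf x Ux; apply: cvgV; [exact: f0|exact: cf].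
move=> kf; have [df Df] := kf; split=> [x Ux|v].
  by apply: differentiableV; [exact: df|exact: f0].
apply: (@Ck_eq _ _ _ _ (fun x => - ((f x)^-1 * (f x)^-1) * 'D_v f x) _ oU).
  move=> x Ux; rewrite deriveV ?f0 //; last exact/diff_derivable/df.
  by rewrite expr2 invfM.
apply: CkM (Df v) => //; apply: CkN => //; apply: CkM => //; apply: IH; exact: CkS.
Qed.

Lemma derive_scale (R : realType) (g : R -> R) (x v : R) :
  differentiable g x -> 'D_v g x = v * 'D_1 g x.
Proof. by move=> dg; rewrite !deriveE // -[v in LHS]mulr1 -[v * 1]/(v *: 1) linearZ. Qed.

Lemma derive_comp (R : realType) (V : normedModType R) (g : R -> R) (f : V -> R) (x v : V) :
  differentiable f x -> differentiable g (f x) ->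
  'D_v (g \o f) x = 'D_1 g (f x) * 'D_v f x.
Proof.
move=> df dg.
rewrite !deriveE //; last exact: differentiable_comp.
by rewrite diff_comp //= -deriveE // derive_scale // deriveE // mulrC.
Qed.

(** The chain rule replaces [g] by ['D_1 g], so the induction on [k] keeps [g] general while [f]
    stays fixed. *)
Lemma Ck_comp (R : realType) (V : normedModType R) k (U : set V) (J : set R)
    (g : R -> R) (f : V -> R) :
  open U -> (forall x, U x -> J (f x)) ->
  Ck_on k J g -> Ck_on k U f -> Ck_on k U (g \o f).
Proof.
move=> oU UJ; elim: k g => [|k IH] g.
  move=> cg cf x Ux; apply: (@continuous_comp _ _ _ f g); first exact: cf.
  exact/cg/UJ.
move=> kg kf; have [dg Dg] := kg; have [df Df] := kf; split=> [x Ux|v].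
  by apply: differentiable_comp; [exact: df|exact/dg/UJ].
apply: (@Ck_eq _ _ _ _ (fun x => ('D_1 g \o f) x * 'D_v f x) _ oU).
  by move=> x Ux; rewrite derive_comp //; [exact: df|exact/dg/UJ].
by apply: CkM (Df v) => //; apply: IH; first [exact: Dg|exact: CkS].
Qed.

(** The derivative of [f \o l] along [v] is ['D_(l v) f \o l], again a composite with the same
    [l]. *)
Lemma Ck_lin_comp (R : realType) (V W : normedModType R) k (U : set V)
    (l : {linear W -> V}) (f : V -> R) :
  continuous l -> open U -> Ck_on k U f -> Ck_on k (l @^-1` U) (f \o l).
Proof.
move=> cl oU.
have olU : open (l @^-1` U) by apply: open_comp => // x _; exact: cl.
elim: k f => [|k IH] f /=.
  by move=> cf x Ux; apply: continuous_comp; [exact: cl|exact: cf].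
move=> [df Df].
have dl x : differentiable l x by exact: linear_differentiable.
split=> [x Ux|v]; first by apply: differentiable_comp; [exact: dl|exact: df].
apply: (Ck_eq olU _ (IH _ (Df (l v)))) => x Ux.
rewrite /= !deriveE; first last.
- exact: df.
- by apply: differentiable_comp; [exact: dl|exact: df].
by rewrite (diff_comp (dl x) (df _ Ux)) /= diff_lin.
Qed.

(** * An implicit function theorem *)

Lemma ballRP (R : realType) (t0 r t : R) :
  ball t0 r t <-> t0 - r < t /\ t < t0 + r.
Proof.
rewrite -ball_normE /= distrC ltr_distl; split=> [/andP[]//|[? ?]].
exact/andP.
Qed.

Lemma lipschitz_of_derive (R : realType) (f : R -> R) (t0 r K : R) :
  (forall t, ball t0 r t -> differentiable f t) ->
  (forall t, ball t0 r t -> `|'D_1 f t| <= K) ->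
  forall a b, ball t0 r a -> ball t0 r b -> `|f b - f a| <= K * `|b - a|.
Proof.
move=> df dK a b.
wlog ab : a b / a <= b.
  move=> H Ba Bb; have [/H|/ltW/H] := leP a b; first exact.
  by rewrite distrC [`|b - a|]distrC; exact.
move=> Ba Bb.
have sub t : t \in `[a, b] -> ball t0 r t.
  rewrite in_itv /= => /andP[h1 h2].
  by move: Ba Bb => /ballRP[? ?] /ballRP[? ?]; apply/ballRP; lra.
have [| |c /sub cab ->] := @MVT_segment R f ('D_1 f) a b ab.
- move=> t /subset_itv_oo_cc/sub/df/diff_derivable dt.
  exact/derivableP.
- by apply: derivable_within_continuous => t /sub/df/diff_derivable.
- by rewrite normrM ler_wpM2r // dK.
Qed.

Lemma smooth_differentiable (R : realType) (V : normedModType R) (U : set V)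
  (f : V -> R) x : smooth_on U f -> U x -> differentiable f x.
Proof. by move=> /(_ 1%N)[df _]; exact: df. Qed.

Lemma smooth_continuous (R : realType) (V : normedModType R) (U : set V)
  (f : V -> R) x : smooth_on U f -> U x -> {for x, continuous f}.
Proof. by move=> /(_ 0%N); exact. Qed.

Lemma smooth_derive (R : realType) (V : normedModType R) (U : set V)
  (f : V -> R) v : smooth_on U f -> smooth_on U ('D_v f).
Proof. by move=> sf k; have [_] := sf k.+1; exact. Qed.

Lemma smooth_subset (R : realType) (V : normedModType R) (U W : set V)
  (f : V -> R) : W `<=` U -> smooth_on U f -> smooth_on W f.
Proof.
move=> WU sf k; move: (sf k); elim: k f {sf} => [|k IH] f /=.
  by move=> cf x /WU; exact: cf.
by move=> [df Df]; split=> [x /WU|v]; [exact: df|exact/IH/Df].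
Qed.

Lemma smooth_linear (R : realType) (V : normedModType R) (U : set V)
  (l : {linear V -> R}) : open U -> continuous l -> smooth_on U l.
Proof.
move=> oU cl [|k]; first by move=> x _; exact: cl.
split=> [x _|v]; first exact: linear_differentiable.
apply: (@Ck_eq _ _ _ _ (fun=> l v) _ oU); last exact: Ck_cst.
by move=> x _; rewrite deriveE ?diff_lin //; exact: linear_differentiable.
Qed.

(** The divided difference; its value on the diagonal makes it continuous there and lets the
    increment factor with no case distinction. *)
Definition slope (R : realType) (f : R -> R) (a b : R) : R :=
  if b == a then 'D_1 f a else (f b - f a) / (b - a).

Lemma slopeE (R : realType) (f : R -> R) (a b : R) :
  f b - f a = slope f a b * (b - a).
Proof.
rewrite /slope; have [->|ba] := eqVneq b a; first by rewrite !subrr mulr0.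
by rewrite divfK // subr_eq0.
Qed.

Lemma slope_continuous (R : realType) (f : R -> R) (a : R) :
  differentiable f a -> {for a, continuous (slope f a)}.
Proof.
move=> df; apply/cvgrPdist_le => e e0.
have H := differentiable_bound df e0; near=> b.
rewrite /slope eqxx; have [_|ba] := eqVneq b a.
  by rewrite subrr normr0 ltW.
have ba0 : b - a != 0 by rewrite subr_eq0.
have : `|f b - f a - 'd f a (b - a)| <= e * `|b - a| by near: b.
rewrite -deriveE // derive_scale // -ler_pdivrMr ?normr_gt0 // -normf_div.
by rewrite distrC mulrBl [_ * 'D_1 f a]mulrC mulfK.
Unshelve. all: by end_near. Qed.

(** * Regularity of solutions of a contractive equation *)

Section Implicit.
Variables (R : realType) (V : normedModType R) (m : nat).
Variables (U : set V) (t0 r : R) (phi : 'I_m -> R -> R).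
Variables (lam : V -> R) (mu : 'I_m -> V -> R) (T : V -> R).
Hypothesis oU : open U.
Hypothesis sphi : forall s, smooth_on (ball t0 r) (phi s).
Hypothesis slam : smooth_on U lam.
Hypothesis smu : forall s, smooth_on U (mu s).
Hypothesis half : forall x t, U x -> ball t0 r t ->
  `|\sum_(s < m) 'D_1 (phi s) t * mu s x| <= 2^-1.

(** The mean value inequality in the variable [t], with [x] frozen. *)
Lemma implicit_contraction x a b : U x -> ball t0 r a -> ball t0 r b ->
  `|\sum_(s < m) (phi s b - phi s a) * mu s x| <= 2^-1 * `|b - a|.
Proof.
move=> Ux Ba Bb.
pose F t := \sum_(s < m) mu s x * phi s t.
have dterm s t : ball t0 r t -> is_derive t 1 (fun t => mu s x * phi s t) (mu s x * 'D_1 (phi s) t).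
  move=> Bt; have dp := diff_derivable (smooth_differentiable (@sphi s) Bt).
  by apply: DeriveDef; [exact: derivableZ|rewrite deriveZ].
have FE : F = \sum_(s < m) (fun t => mu s x * phi s t) by apply/funext => t; rewrite fct_sumE.
have dF t : ball t0 r t -> differentiable F t.
  move=> Bt; rewrite FE; apply: differentiable_sum => s.
  by apply/derivable1_diffP; have [] := dterm s t Bt.
have -> : \sum_(s < m) (phi s b - phi s a) * mu s x = F b - F a.
  by rewrite -sumrB; apply: eq_bigr => s _; ring.
apply: (lipschitz_of_derive dF) => // t Bt.
rewrite FE derive_sum; last by move=> s; have [] := dterm s t Bt.
apply: le_trans (half Ux Bt); rewrite le_eqVlt; apply/orP; left; apply/eqP.
by congr (`|_|); apply: eq_bigr => s _; have [_ ->] := dterm s t Bt; rewrite mulrC.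
Qed.

Hypothesis BT : forall x, U x -> ball t0 r (T x).
Hypothesis TE : forall x, U x -> T x = lam x + \sum_(s < m) phi s (T x) * mu s x.

(** Freezing the parameter at [T x] leaves a function smooth in [y]; an increment of [T] is one of
    [G x] plus a term controlled by the contraction. *)
Let G (x y : V) := lam y + \sum_(s < m) phi s (T x) * mu s y.

Lemma implicit_increment x y : U x -> U y ->
  T y - T x = G x y - G x x + \sum_(s < m) (phi s (T y) - phi s (T x)) * mu s y.
Proof.
move=> Ux Uy; rewrite {1}(TE Uy) {1}(TE Ux) /G.
under [X in _ = _ + X]eq_bigr do rewrite mulrBl.
rewrite sumrB; ring.
Qed.

Lemma implicit_differentiable_G x : U x -> differentiable (G x) x.
Proof.
move=> Ux.
suff /(_ 1%N)[] : smooth_on U (G x) by move=> dG _; exact: dG.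
move=> k; apply: CkD => //; apply: Ck_sum => // s; apply: CkM => //; first exact: Ck_cst.
exact: smu.
Qed.

(** The contraction term is at most half of [|T y - T x|] and is absorbed on the left, so the
    increment of [T] is at most twice that of [G x]. *)
Lemma implicit_continuous x : U x -> {for x, continuous T}.
Proof.
move=> Ux; apply/cvgrPdist_le => e e0.
have /differentiable_continuous := implicit_differentiable_G Ux.
move=> /cvgr_dist_le/(_ (e / 2)); rewrite divr_gt0 // => /(_ isT) cG.
near=> y.
have Uy : U y by near: y; exact: open_nbhs_nbhs.
have h1 : `|G x x - G x y| <= e / 2 by near: y.
have := implicit_increment Ux Uy.
have := implicit_contraction Uy (BT Ux) (BT Uy).
set S := \sum_(s < m) _ => hS E.
rewrite distrC; have : `|T y - T x| <= `|G x x - G x y| + `|S|.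
  by rewrite [`|G x x - _|]distrC E; exact: ler_normD.
lra.
Unshelve. all: by end_near. Qed.

Let D x := \sum_(s < m) 'D_1 (phi s) (T x) * mu s x.

Lemma implicit_denom_neq0 x : U x -> 1 - D x != 0.
Proof.
move=> Ux; have := half Ux (BT Ux); rewrite -/(D x) ler_norml => /andP[_ h].
by rewrite gt_eqF //; lra.
Qed.

(** Writing the increments of [phi s] as divided differences gives the exact identity
    [(1 - E y) * (T y - T x) = G x y - G x x]. The continuity of [T] already obtained makes [E]
    continuous at [x], and Carathéodory's criterion applies. *)
Lemma implicit_is_diff x : U x -> is_diff x T ((1 - D x)^-1 \*: 'd (G x) x).
Proof.
move=> Ux.
pose E y := \sum_(s < m) slope (phi s) (T x) (T y) * mu s y.
have EDx : E x = D x by apply: eq_bigr => s _; rewrite /slope eqxx.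
have cE : {for x, continuous (fun y => 1 - E y)}.
  apply: cvgB; first exact: cvg_cst.
  apply: cvg_big => [|s _]; first exact: add_continuous.
  apply: cvgM; last exact: smooth_continuous (@smu s) Ux.
  apply: (@continuous_comp _ _ _ T (slope (phi s) (T x))).
    exact: implicit_continuous.
  exact/slope_continuous/(smooth_differentiable (@sphi s))/BT.
have := @diff_caratheodory _ _ T (G x) (fun y => (1 - E y)^-1) x
  (implicit_differentiable_G Ux).
rewrite EDx; apply; first by apply: cvgV cE; rewrite EDx implicit_denom_neq0.
have E0 : \forall y \near x, 1 - E y != 0.
  by move: cE => /cvgr_neq0; apply; rewrite EDx implicit_denom_neq0.
near=> y.
have Uy : U y by near: y; exact: open_nbhs_nbhs.
have n0 : 1 - E y != 0 by near: y.
apply: (mulfI n0); rewrite mulVKf // mulrBl mul1r {1}implicit_increment //.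
suff -> : \sum_(s < m) (phi s (T y) - phi s (T x)) * mu s y = E y * (T y - T x) by rewrite addrK.
by rewrite mulr_suml; apply: eq_bigr => s _; rewrite slopeE mulrAC.
Unshelve. all: by end_near. Qed.

(** Bootstrapping: the derivative of [T] is a rational expression in functions of [T] and smooth
    data, so [T] of class C^k has derivatives of class C^k. *)
Lemma implicit_smooth : smooth_on U T.
Proof.
elim=> [|k IH]; first exact: implicit_continuous.
split=> [x Ux|v]; first by have [] := implicit_is_diff Ux.
have kp (f : R -> R) : smooth_on (ball t0 r) f -> Ck_on k U (f \o T).
  by move=> sf; apply: Ck_comp (sf k) IH.
apply: (@Ck_eq _ _ _ _ (fun x => (1 - D x)^-1 *
    ('D_v lam x + \sum_(s < m) phi s (T x) * 'D_v (mu s) x)) _ oU).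
  move=> x Ux; have [dT dTE] := implicit_is_diff Ux.
  rewrite [RHS]deriveE // dTE /= -deriveE; last exact: implicit_differentiable_G.
  congr (_ * _).
  have dl := diff_derivable (v := v) (smooth_differentiable slam Ux).
  have dterm s : is_derive x v (fun y => phi s (T x) * mu s y) (phi s (T x) * 'D_v (mu s) x).
    have dm := diff_derivable (v := v) (smooth_differentiable (@smu s) Ux).
    by apply: DeriveDef; [exact: derivableZ|rewrite deriveZ].
  have -> : G x = lam + \sum_(s < m) (fun y => phi s (T x) * mu s y).
    by apply/funext => y; rewrite /G !fctE fct_sumE.
  have ds : derivable (\sum_(s < m) (fun y : V => phi s (T x) * mu s y)) x v.
    by apply: derivable_sum => s; have [] := dterm s.
  rewrite deriveD //.
  rewrite derive_sum; last by move=> s; have [] := dterm s.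
  by congr (_ + _); apply: eq_bigr => s _; have [_ ->] := dterm s.
apply: CkM => //.
  apply: CkV => //; first exact: implicit_denom_neq0.
  apply: CkD => //; first exact: Ck_cst.
  apply: CkN => //; apply: Ck_sum => // s; apply: CkM (smu _ _) => //.
  by apply: (kp ('D_1 (phi s))); exact: smooth_derive.
apply: (CkD oU (smooth_derive v slam k)); apply: Ck_sum => // s.
by apply: (CkM oU (kp _ (@sphi s)) (smooth_derive v (@smu s) k)).
Qed.
End Implicit.

(** * Uniqueness and existence of solutions *)

Section ImplicitFunction.
Variables (R : realType) (V : normedModType R) (m : nat).
Variables (U : set V) (t0 r : R) (phi : 'I_m -> R -> R).
Variables (lam : V -> R) (mu : 'I_m -> V -> R).
Hypothesis sphi : forall s, smooth_on (ball t0 r) (phi s).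
Hypothesis half : forall x t, U x -> ball t0 r t ->
  `|\sum_(s < m) 'D_1 (phi s) t * mu s x| <= 2^-1.

(** The distance between two solutions is at most half of itself. *)
Lemma implicit_unique x a b : U x -> ball t0 r a -> ball t0 r b ->
  a = lam x + \sum_(s < m) phi s a * mu s x ->
  b = lam x + \sum_(s < m) phi s b * mu s x -> a = b.
Proof.
move=> Ux Ba Bb Ea Eb.
have := implicit_contraction sphi half Ux Ba Bb.
have -> : \sum_(s < m) (phi s b - phi s a) * mu s x = b - a.
  under eq_bigr do rewrite mulrBl.
  by rewrite sumrB {2}Ea {2}Eb; ring.
move=> H; apply/eqP; rewrite -subr_eq0 -normr_eq0 distrC eq_le normr_ge0 andbT.
lra.
Qed.

Hypothesis oU : open U.
Hypothesis r0 : 0 < r.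
Hypothesis slam : smooth_on U lam.
Hypothesis smu : forall s, smooth_on U (mu s).

(** An intermediate value argument in [t]. At [p] the defect [F] vanishes at [t0] and, by the
    contraction, is positive at [t0 + r / 2] and negative at [t0 - r / 2]. Both signs persist for
    [x] near [p], so a zero lies in between. *)
Lemma implicit_exists p : U p ->
  t0 = lam p + \sum_(s < m) phi s t0 * mu s p ->
  \forall x \near p, exists t,
    ball t0 r t /\ t = lam x + \sum_(s < m) phi s t * mu s x.
Proof.
move=> Up Ep; have rgt0 := r0.
pose F t x := t - (lam x + \sum_(s < m) phi s t * mu s x).
have B0 : ball t0 r t0 by exact: ballxx.
have cF t : {for p, continuous (F t)}.
  apply: cvgB; first exact: cvg_cst.
  apply: cvgD; first exact: smooth_continuous slam Up.
  apply: cvg_big => [|s _]; first exact: add_continuous.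
  by apply: cvgM; [exact: cvg_cst|exact: smooth_continuous (@smu s) Up].
(* The equation at [p] absorbs [lam p]; the remaining sum is at most [r / 4] in absolute value when
   [t] is [t0 + r / 2] or [t0 - r / 2]. *)
have FE t : F t p = (t - t0) - \sum_(s < m) (phi s t - phi s t0) * mu s p.
  rewrite /F; under [in RHS]eq_bigr do rewrite mulrBl.
  by rewrite sumrB; lra.
have [b bE] : exists b, b = t0 + r / 2 by eexists.
have [a aE] : exists a, a = t0 - r / 2 by eexists.
have Bb : ball t0 r b by apply/ballRP; lra.
have Ba : ball t0 r a by apply/ballRP; lra.
have Fb : 0 < F b p.
  have := implicit_contraction sphi half Up B0 Bb.
  rewrite FE; set S := \sum_(s < m) _.
  have -> : b - t0 = r / 2 by lra.
  rewrite [`|r / 2|]ger0_norm ?ler_norml; last by lra.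
  by move=> /andP[_ h]; lra.
have Fa : F a p < 0.
  have := implicit_contraction sphi half Up B0 Ba.
  rewrite FE; set S := \sum_(s < m) _.
  have -> : a - t0 = - (r / 2) by lra.
  rewrite normrN [`|r / 2|]ger0_norm ?ler_norml; last by lra.
  by move=> /andP[h _]; lra.
near=> x.
have Ux : U x by near: x; exact: open_nbhs_nbhs.
have Fbx : 0 < F b x by near: x; exact: (cvgr_gt _ (@cF _)).
have Fax : F a x < 0 by near: x; exact: (cvgr_lt _ (@cF _)).
have sub t : t \in `[a, b] -> ball t0 r t.
  by rewrite in_itv /= => /andP[h1 h2]; apply/ballRP; lra.
have cFx : {within `[a, b], continuous (F ^~ x)}.
  apply: continuous_in_subspaceT => t; rewrite inE /= => /sub Bt.
  apply: cvgB; first exact: cvg_id.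
  apply: cvgD; first exact: cvg_cst.
  apply: cvg_big => [|s _]; first exact: add_continuous.
  by apply: cvgM; [exact: smooth_continuous (@sphi s) Bt|exact: cvg_cst].
have [||c /sub Bc /eqP cE] := @IVT R (F ^~ x) a b 0 _ cFx.
- lra.
- by rewrite ge_min le_max (ltW Fax) (ltW Fbx) orbT.
by exists c; split => //; apply/eqP; rewrite -subr_eq0.
Unshelve. all: by end_near. Qed.

(** Any choice of a solution inside the ball is automatically smooth, so [T] may be picked
    pointwise; taking an interior makes its domain open. *)
Lemma implicit_function p : U p ->
  t0 = lam p + \sum_(s < m) phi s t0 * mu s p ->
  exists (W : set V) (T : V -> R),
    [/\ open W, W p, W `<=` U, smooth_on W T &
      forall x, W x -> ball t0 r (T x) /\
        T x = lam x + \sum_(s < m) phi s (T x) * mu s x].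
Proof.
move=> Up Ep.
pose P x t := ball t0 r t /\ t = lam x + \sum_(s < m) phi s t * mu s x.
pose W := U `&` [set x | exists t, P x t]°.
have WU : W `<=` U by move=> x [].
have oW : open W by apply: openI => //; exact: open_interior.
pose T x := xget t0 (P x).
have TP x : W x -> P x (T x).
  by move=> [_ /interior_subset[t Pt]]; exact: (xgetI _ Pt).
exists W, T; split=> //.
  by split=> //; exact: implicit_exists.
apply: (implicit_smooth oW sphi (smooth_subset WU slam)
  (fun s => smooth_subset WU (@smu s))).
- by move=> x t /WU; exact: half.
- by move=> x /TP[].
- by move=> x /TP[].
Qed.
End ImplicitFunction.

(** With [a] the derivative at [t0], [u t = c] is the fixed point equation
    [t = c / a + (t - u t / a)], whose last term has derivative 0 at [t0]. The implicit function
    theorem with a single [phi] yields [h], and uniqueness makes it a left inverse too. *)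
Lemma smooth_inverse (R : realType) (I : set R) (u : R -> R) (t0 : R) :
  open I -> I t0 -> smooth_on I u -> 'D_1 u t0 != 0 ->
  exists (r : R) (J : set R) (h : R -> R),
    [/\ 0 < r, ball t0 r `<=` I, open J /\ J (u t0), smooth_on J h &
      (forall c, J c -> ball t0 r (h c) /\ u (h c) = c) /\
      (forall t, ball t0 r t -> J (u t) -> h (u t) = t)].
Proof.
move=> oI It0 su; set a := 'D_1 u t0 => a0.
pose phi (s : 'I_1) t := t - u t / a.
have sphi s : smooth_on I (phi s).
  move=> k; apply: (@CkD _ _ _ _ id) => //.
    by apply: (@smooth_linear _ _ I idfun) => // x; exact: cvg_id.
  by apply: CkN => //; apply: CkM => //; exact: Ck_cst.
have Dphi t s : I t -> 'D_1 (phi s) t = 1 - 'D_1 u t / a.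
  move=> It; have du := diff_derivable (v := 1 : R) (smooth_differentiable su It).
  have -> : phi s = id - (a^-1 *: u).
    by apply/funext => x; rewrite /phi !fctE [u x / a]mulrC.
  rewrite deriveB //; first by rewrite derive_id deriveZ // mulrC.
  exact: derivableZ.
have : \forall t \near t0, I t /\ `|1 - 'D_1 u t / a| <= 2^-1.
  have c : {for t0, continuous (fun t => 1 - 'D_1 u t / a)}.
    apply: cvgB; first exact: cvg_cst.
    apply: cvgM; last exact: cvg_cst.
    exact: (smooth_continuous (smooth_derive (1 : R) su) It0).
  near=> t; split; first by near: t; exact: open_nbhs_nbhs.
  near: t; apply: (cvgr_norm_le _ c).
  by rewrite divff // subrr normr0 invr_gt0.
move=> /nbhs_ballP[r /= r0 Hr].
have [|||||W [T [oW Wp _ sT TE]]] := @implicit_function R R 1 setT t0 r phi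
  (fun c => a^-1 * c) (fun _ _ => 1) _ _ openT r0 _ _ (u t0) Logic.I.
- by move=> s; apply: smooth_subset (sphi s) => t /Hr[].
- move=> x t _ /Hr[It]; rewrite big_ord1 mulr1 Dphi //.
- move=> k; apply: (@CkM _ _ _ _ (fun=> a^-1) id openT); first exact: Ck_cst.
  by apply: (@smooth_linear _ _ setT idfun openT) => x; exact: cvg_id.
- by move=> s k; exact: Ck_cst.
- by rewrite big_ord1 mulr1 /phi; ring.
have eqP (c t : R) : t = a^-1 * c + \sum_(s < 1) phi s t * 1 <-> u t = c.
  rewrite big_ord1 mulr1 /phi; split=> [E|->]; last by ring.
  by apply: (divIf a0); lra.
exists r, W, T; split=> //; first by move=> t /Hr[].
split=> [c /TE[BT /eqP]//|t Bt Wt].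
have [BT ET] := TE _ Wt.
apply: (@implicit_unique R R 1 setT t0 r phi (fun c => a^-1 * c) (fun _ _ => 1) _ _ (u t)) => //.
- by move=> s; apply: smooth_subset (sphi s) => t' /Hr[].
- by move=> x t' _ /Hr[It]; rewrite big_ord1 mulr1 Dphi.
- exact/eqP.
Unshelve. all: by end_near. Qed.

(** * Leaves and hyperplanes *)

Lemma ball_segment (R : realType) (V : normedModType R) (p : V) (r t : R) (x y : V) :
  0 <= t <= 1 -> ball p r x -> ball p r y -> ball p r (x + t *: (y - x)).
Proof.
move=> /andP[t0 t1]; rewrite -!ball_normE /= => Bx By.
have -> : p - (x + t *: (y - x)) = (1 - t) *: (p - x) + t *: (p - y).
  rewrite scalerBl scale1r -addrA [- _ + _]addrC -scalerBr opprD addrA.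
  have -> : p - y - (p - x) = x - y by rewrite opprB addrC addrA subrK.
  by rewrite -scalerN opprB.
apply: (le_lt_trans (ler_normD _ _)); rewrite !normrZ !ger0_norm //; last lra.
(* The strict inequality comes from the term in [x], whose weight vanishes exactly when [t = 1]. *)
have [->|tn] := eqVneq t 1; first by rewrite subrr mul0r mul1r add0r.
have h1 : (1 - t) * `|p - x| < (1 - t) * r.
  by rewrite ltr_pM2l // subr_gt0 lt_neqAle tn.
have h2 : t * `|p - y| <= t * r by rewrite ler_wpM2l // ltW.
lra.
Qed.

Lemma segment_continuous (R : realType) (V : normedModType R) (x y : V) :
  continuous (fun t : R => x + t *: (y - x)).
Proof.
move=> t; apply: cvgD; first exact: cvg_cst.
by apply: cvgZ; [exact: cvg_id|exact: cvg_cst].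
Qed.

(** A nonempty relatively clopen part [B] of [K] meets [A], as it is open and [A] is dense in [K].
    It then contains [A] by connectedness, and all of [K] because it is closed. This is used to add
    one limit point to a leaf. *)
Lemma connected_between (T : topologicalType) (A K : set T) :
  connected A -> A `<=` K -> K `<=` closure A -> connected K.
Proof.
move=> cA AK KA B [b Bb] [C oC BC] [D cD BD].
have [AB0|] := pselect (A `&` B = set0).
  have [Kb Cb] : (K `&` C) b by rewrite -BC.
  have [z [Az Cz]] := KA _ Kb C (open_nbhs_nbhs (conj oC Cb)).
  suff : (A `&` B) z by rewrite AB0.
  by split=> //; rewrite BC; split=> //; exact: AK.
move=> /eqP/set0P AB0.
have ABA : A `&` B = A.
  apply: cA => //.
  - by exists C => //; rewrite BC setIA (setIidl AK).
  - by exists D => //; rewrite BD setIA (setIidl AK).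
rewrite BD; apply/seteqP; split=> [z []//|z Kz]; split=> //.
suff : closure D z by rewrite -(closure_id D).1.
apply: closure_subset (KA _ Kz) => w Aw.
have : (A `&` B) w by rewrite ABA.
by rewrite BD => -[_ []].
Qed.

Lemma closure_level (R : realType) (V : normedModType R) (A : set V)
  (f : V -> R) (c : R) z : {for z, continuous f} -> closure A z ->
  (forall w, A w -> f w = c) -> f z = c.
Proof.
move=> cf Az fA; apply: contrapT => /eqP; rewrite -subr_eq0 => fz.
have cg : {for z, continuous (fun w => f w - c)}.
  by apply: cvgB => //; exact: cvg_cst.
have [w [/fA -> /=]] := Az _ (cvgr_neq0 _ cg fz).
by rewrite subrr eqxx.
Qed.

Section Leaves.
Variables (R : realType) (n : nat).
Implicit Types (U O : set 'rV[R]_n) (f : 'rV[R]_n -> R) (a x y p : 'rV[R]_n).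

Definition dot a x : R := \sum_(i < n) a 0 i * x 0 i.

Lemma dotD a x y : dot a (x + y) = dot a x + dot a y.
Proof. by rewrite -big_split; apply: eq_bigr => i _; rewrite mxE mulrDr. Qed.

Lemma dotZ a t x : dot a (t *: x) = t * dot a x.
Proof. by rewrite mulr_sumr; apply: eq_bigr => i _; rewrite mxE mulrCA. Qed.

Lemma dotB a x y : dot a (x - y) = dot a x - dot a y.
Proof. by rewrite -scaleN1r dotD dotZ mulN1r. Qed.

Lemma dot_neq0 a : a != 0 -> dot a a != 0.
Proof.
apply: contra_neq => H; apply/rowP => i; rewrite mxE.
have := H; rewrite /dot => /eqP; rewrite psumr_eq0; last by move=> j _; exact: sqr_ge0.
by move=> /allP/(_ i (mem_index_enum i)) /=; rewrite mulf_eq0 orbb => /eqP.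
Qed.

Lemma diff_partial f x v : differentiable f x ->
  'd f x v = \sum_(i < n) partial i f x * v 0 i.
Proof.
move=> df; rewrite {1}(row_sum_delta v) linear_sum.
by apply: eq_bigr => i _; rewrite linearZ /partial deriveE // mulrC.
Qed.

Lemma hyperplane_segment a b t x y : hyperplane a b x -> hyperplane a b y ->
  hyperplane a b (x + t *: (y - x)).
Proof.
rewrite /hyperplane /= -!/(dot _ _) => Hx Hy.
by rewrite dotD dotZ dotB Hx Hy subrr mulr0 addr0.
Qed.

Lemma itv01 (t : R) : `[0, 1]%classic t = (0 <= t <= 1).
Proof. by rewrite /= in_itv. Qed.

(** A ball meets a hyperplane in a convex set, so the segment from [x] to any other point of the
    intersection is a connected part of the level set. *)
Lemma leaf_level U f a b p r x : U = ball p r -> U x ->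
  (forall y, U y -> f y = f x <-> hyperplane a b y) ->
  leaf U f x = hyperplane a b `&` U.
Proof.
move=> UE Ux H; apply/seteqP; split=> [y /connected_component_sub[Uy]|y [Hy Uy]].
  by move=> /= E; split=> //; exact/H.
pose g t := x + t *: (y - x).
suff : g @` `[0, 1] `<=` leaf U f x.
  apply; exists 1 => /=; first by rewrite in_itv /= ler01 lexx.
  by rewrite /g scale1r subrKC.
apply: connected_component_max.
- by exists 0 => /=; [rewrite in_itv /= ler01 lexx|rewrite /g scale0r addr0].
- move=> _ [t t01 <-]; have Ug : U (g t).
    rewrite UE; apply: ball_segment; [by rewrite -itv01|by rewrite -UE..].
  by split=> //=; apply/H => //; apply: hyperplane_segment => //; exact/H.
- apply: connected_continuous_connected; first exact: segment_connected.
  exact/continuous_subspaceT/segment_continuous.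
Qed.

(** Along the segment from [x] to [y], the leaf is relatively open since it is the trace of [O] on
    the hyperplane, and relatively closed since leaves are closed in [U]. It contains [x], hence the
    whole segment. *)
Lemma leaf_convex U f a b O p r x y : open U -> open O ->
  smooth_on U f ->
  leaf U f x = hyperplane a b `&` O -> ball p r `<=` U ->
  ball p r x -> ball p r y -> hyperplane a b y -> f y = f x.
Proof.
move=> oU oO sf LE BU Bx By Hy.
have Ux := BU _ Bx.
have Lx : leaf U f x x by exact: connected_component_refl.
have Hx : hyperplane a b x by move: Lx; rewrite LE => -[].
pose g t := x + t *: (y - x).
have Bg t : `[0, 1]%classic t -> ball p r (g t) by rewrite itv01 => ?; exact: ball_segment.
have Hg t : hyperplane a b (g t) by exact: hyperplane_segment.
have cg : continuous g by exact: segment_continuous.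
(* Adjoining a limit point in [U] preserves both connectedness and the value of [f], so maximality
   of the component puts it in the leaf. *)
have Lclosed z : U z -> closure (leaf U f x) z -> leaf U f x z.
  move=> Uz Cz.
  have fz : f z = f x.
    apply: (closure_level (smooth_continuous sf Uz) Cz) => w.
    by move=> /connected_component_sub[].
  suff : leaf U f x `|` [set z] `<=` leaf U f x by apply; right.
  apply: connected_component_max; first by left.
    by move=> w [/connected_component_sub//|->].
  apply: (@connected_between _ (leaf U f x)); first exact: component_connected.
    by move=> w; left.
  by move=> w [/subset_closure//|->].
have SE : `[0, 1] `&` g @^-1` (leaf U f x) = `[0, 1]%classic.
  apply: (@segment_connected R 0 1).
  - exists 0; split; first by rewrite itv01 lexx ler01.
    by rewrite /= /g scale0r addr0.
  - exists (g @^-1` O); first by apply: open_comp => // t _; exact: cg.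
    by rewrite LE; apply/seteqP; split=> t [t01]; [move=> []|split].
  - exists (g @^-1` closure (leaf U f x)).
      by apply: closed_comp => //; exact: closed_closure.
    apply/seteqP; split=> t [t01 Lt]; split=> //; first exact: subset_closure.
    by apply: Lclosed => //; exact/BU/Bg.
have : (`[0, 1] `&` g @^-1` (leaf U f x)) 1 by rewrite SE itv01 lexx ler01.
move=> [_ /= /connected_component_sub[_ /=]].
by rewrite /g scale1r subrKC.
Qed.

Lemma derive_hyperplane f a b O x v : O x -> open O ->
  (forall y, hyperplane a b y -> O y -> f y = f x) ->
  hyperplane a b x -> dot a v = 0 -> 'D_v f x = 0.
Proof.
move=> Ox oO fE Hx av0; rewrite /derive; apply: cvg_lim => //.
apply: cvg_near_cst.
have : \forall h \near (0 : R), O (h *: v + x).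
  have c : {for 0, continuous (fun h : R => h *: v + x)}.
    apply: cvgD; last exact: cvg_cst.
    by apply: cvgZ; [exact: cvg_id|exact: cvg_cst].
  by apply: c; rewrite scale0r add0r; exact: open_nbhs_nbhs.
move=> /nbhs_dnbhs; apply: filterS => h Oh /=.
rewrite fE ?subrr ?scaler0 //.
by rewrite /hyperplane /= -/(dot _ _) dotD dotZ av0 mulr0 add0r.
Qed.

(** The differential of [f] at [x] vanishes on the direction of the hyperplane carrying the leaf.
    Being nonzero, it is proportional to [dot a], so the tangent hyperplane is the carrying one and
    [leaf_convex] applies. *)
Lemma hyperplanar_tangent U f p r x y : open U -> smooth_on U f ->
  hyperplanar_foliation U f -> ball p r `<=` U -> ball p r x -> ball p r y ->
  (exists i, partial i f x != 0) ->
  \sum_(i < n) partial i f x * (y - x) 0 i = 0 -> f y = f x.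
Proof.
move=> oU sf hf BU Bx By [i fi] E.
have Ux := BU _ Bx.
have [a [b [Q [a0 oQ LE]]]] := hf x Ux.
have df := smooth_differentiable sf Ux.
have [Hx Qx] : (hyperplane a b `&` Q) x.
  by rewrite -LE; exact: connected_component_refl.
apply: (leaf_convex oU oQ sf LE BU Bx By).
have D0 v : dot a v = 0 -> 'd f x v = 0.
  move=> av; rewrite -deriveE //; apply: derive_hyperplane Qx oQ _ Hx av.
  move=> z Hz Qz; have : leaf U f x z by rewrite LE.
  by move=> /connected_component_sub[].
have aa := dot_neq0 a0.
(* [k v *: a] is the orthogonal projection of [v] on the line of [a]. *)
pose k v := dot a v / dot a a.
have dE v : 'd f x v = k v * 'd f x a.
  have : 'd f x (v - k v *: a) = 0 by apply: D0; rewrite dotB dotZ divfK // subrr.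
  by rewrite linearB linearZ /= => /eqP; rewrite subr_eq0 => /eqP.
have da : 'd f x a != 0.
  apply: contraNneq fi => da; rewrite /partial deriveE //.
  by rewrite dE da mulr0.
have : 'd f x (y - x) = 0 by rewrite diff_partial.
rewrite dE => /eqP; rewrite mulf_eq0 (negbTE da) orbF mulf_eq0 invr_eq0 (negbTE aa) orbF.
by rewrite dotB subr_eq0 => /eqP; rewrite {2}/dot Hx.
Qed.
End Leaves.

(** * Hyperplanar foliations satisfy the implicit equation *)

Section RowCoordinate.
Variables (R : realType) (n : nat) (i : 'I_n).

Fact row_coord_linear : linear (fun x : 'rV[R]_n => x 0 i).
Proof. by move=> t x y; rewrite !mxE. Qed.

Let row_coord : {linear 'rV[R]_n -> R} := HB.pack (fun x : 'rV[R]_n => x 0 i)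
  (GRing.isLinear.Build R 'rV[R]_n R _ _ row_coord_linear).

Lemma smooth_coord (U : set 'rV[R]_n) : open U -> smooth_on U (fun x => x 0 i).
Proof.
by move=> oU; apply: (@smooth_linear _ _ U row_coord) => //; exact: coord_continuous.
Qed.

Lemma derive_coord (x v : 'rV[R]_n) : 'D_v (fun y : 'rV[R]_n => y 0 i) x = v 0 i.
Proof.
have c : continuous row_coord by exact: coord_continuous.
have dc : differentiable row_coord x by exact: linear_differentiable.
by rewrite -[LHS]/('D_v row_coord x) deriveE // diff_lin.
Qed.
End RowCoordinate.

(** * The x_n-axis and the normal form around it *)

Section Coordinates.
Variables (R : realType) (m : nat).
Implicit Types (U : set 'rV[R]_m.+1) (f : 'rV[R]_m.+1 -> R) (x : 'rV[R]_m.+1).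

Lemma axis_point_max t : (axis_point m t : 'rV[R]_m.+1) 0 ord_max = t.
Proof. by rewrite /axis_point !mxE !eqxx mulr1. Qed.

Lemma axis_point_widen t s :
  (axis_point m t : 'rV[R]_m.+1) 0 (widen_ord (leqnSn m) s) = 0.
Proof.
rewrite /axis_point !mxE eqxx /=; have /negbTE -> // : widen_ord (leqnSn m) s != ord_max.
  by rewrite -val_eqE /= ltn_eqF.
by rewrite mulr0.
Qed.

Lemma implicit_arg_axis (Psi : 'I_m -> R -> R) c t :
  implicit_arg Psi c (axis_point m t) = t.
Proof.
rewrite /implicit_arg axis_point_max big1 ?addr0 // => s _.
by rewrite axis_point_widen mulr0.
Qed.

Lemma axis_point_continuous : continuous (axis_point m : R -> 'rV[R]_m.+1).
Proof. by move=> t; apply: cvgZ; [exact: cvg_id|exact: cvg_cst]. Qed.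

Fact axis_point_linear : linear (axis_point m : R -> 'rV[R]_m.+1).
Proof. by move=> u y z; rewrite /axis_point scalerDl scalerA. Qed.

HB.instance Definition _ :=
  GRing.isLinear.Build R R 'rV[R]_m.+1 _ (axis_point m) axis_point_linear.

Lemma smooth_axis U f : open U -> smooth_on U f ->
  smooth_on (axis_point m @^-1` U) (f \o axis_point m).
Proof.
move=> oU sf k.
pose l : {linear R -> 'rV[R]_m.+1} := axis_point m.
exact: (@Ck_lin_comp _ _ _ k U l f axis_point_continuous oU (sf k)).
Qed.

Lemma derive_axis f t : differentiable f (axis_point m t) ->
  'D_1 (f \o axis_point m) t = partial ord_max f (axis_point m t).
Proof.
move=> df; pose l : {linear R -> 'rV[R]_m.+1} := axis_point m.
have dl : differentiable l t by apply: linear_differentiable; exact: axis_point_continuous.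
rewrite /partial !deriveE //; last exact: (differentiable_comp dl df).
rewrite (diff_comp dl df) /= diff_lin /=; last exact: axis_point_continuous.
by rewrite /axis_point scale1r.
Qed.

(** On the axis the other coordinates vanish, and so does the sum; joint continuity in [(t, x)]
    keeps it small on a product of balls. *)
Lemma implicit_arg_contraction (I : set R) (t0 : R) (phi : 'I_m -> R -> R) :
  open I -> I t0 -> (forall s, smooth_on I (phi s)) ->
  exists r, [/\ 0 < r, ball t0 r `<=` I &
    forall x t, ball (axis_point m t0) r x -> ball t0 r t ->
      `|\sum_(s < m) 'D_1 (phi s) t * x 0 (widen_ord (leqnSn m) s)| <= 2^-1].
Proof.
move=> oI It0 sphi; set p : 'rV[R]_m.+1 := axis_point m t0.
pose F (z : R * 'rV[R]_m.+1) :=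
  \sum_(s < m) 'D_1 (phi s) z.1 * z.2 0 (widen_ord (leqnSn m) s).
have cF : {for (t0, p), continuous F}.
  apply: cvg_big => [|s _]; first exact: add_continuous.
  apply: cvgM.
    apply: (@continuous_comp _ _ _ fst ('D_1 (phi s)) (t0, p)); first exact: cvg_fst.
    exact: (smooth_continuous (smooth_derive (1 : R) (@sphi s)) It0).
  apply: (@continuous_comp _ _ _ snd (fun x : 'rV[R]_m.+1 => x 0 _) (t0, p)); first exact: cvg_snd.
  exact: coord_continuous.
have F0 : F (t0, p) = 0.
  by rewrite /F big1 // => s _; rewrite /= axis_point_widen mulr0.
have h2 : `|F (t0, p)| < 2^-1 by rewrite F0 normr0 invr_gt0.
have : nbhs (t0, p) [set z | `|F z| <= 2^-1].
  exact: (cvgr_norm_le _ cF).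
move=> /nbhs_ballP[r1 /= r10 H1].
have /nbhs_ballP[r2 /= r20 H2] := open_nbhs_nbhs (conj oI It0).
exists (Num.min r1 r2); split; first by rewrite lt_min r10.
  by move=> t Bt; apply: H2; apply: le_ball Bt; rewrite ge_min lexx orbT.
move=> x t Bx Bt; apply: (H1 (t, x)); split=> /=.
  by apply: le_ball Bt; rewrite ge_min lexx.
by apply: le_ball Bx; rewrite ge_min lexx.
Qed.

Lemma hyperplanar_normal_form (U : set 'rV[R]_m.+1) f t0 :
  open U -> U (axis_point m t0) -> smooth_on U f -> hyperplanar_foliation U f ->
  transversal_to_coordinates U f ->
  exists (V : set 'rV[R]_m.+1) (I J : set R) (u0 : R -> R) (Psi : 'I_m -> R -> R),
       [/\ open V, V (axis_point m t0), V `<=` U,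
           admissible_data t0 I J u0 Psi
         & solves_implicit_equation V I J u0 Psi f].
Proof.
move=> oU Up sf hf tf; set p : 'rV[R]_m.+1 := axis_point m t0.
have /nbhs_ballP[rho /= rho0 BU] := open_nbhs_nbhs (conj oU Up).
pose I := axis_point m @^-1` (ball p rho).
have oI : open I.
  by apply: open_comp; [move=> t _; exact: axis_point_continuous|exact: ball_open].
have It0 : I t0 by exact: ballxx.
have IU t : I t -> U (axis_point m t) by move=> /BU.
have sfB : smooth_on (ball p rho) f by exact: smooth_subset sf.
have oB : open (ball p rho) by exact: ball_open.
pose u0 := f \o axis_point m.
have su0 : smooth_on I u0 by exact: smooth_axis.
have du0 t : I t -> 'D_1 u0 t != 0.
  move=> It; rewrite derive_axis; first exact/tf/IU.
  exact/(smooth_differentiable sf)/IU.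
(* Coefficients of the tangent hyperplane at the axis point of parameter [t], scaled to have
   coefficient 1 on x_n. *)
pose psi s t := partial (widen_ord (leqnSn m) s) f (axis_point m t) / 'D_1 u0 t.
have spsi s : smooth_on I (psi s).
  move=> k; apply: CkM => //.
    apply: (smooth_axis oB); exact: smooth_derive.
  by apply: CkV => //; exact: (smooth_derive (1 : R) su0).
have psi0 s t : I t -> psi s t != 0.
  by move=> It; rewrite mulf_neq0 ?invr_neq0 ?du0 //; exact/tf/IU.
have [r1 [J [h [r10 r1I [oJ Jc] sh [hJ hu]]]]] :=
  smooth_inverse oI It0 su0 (du0 _ It0).
have : \forall t \near t0, ball t0 r1 t /\ J (u0 t).
  near=> t; split; first by near: t; exact: nbhsx_ballx.
  near: t; apply: (smooth_continuous su0 It0); exact: open_nbhs_nbhs.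
(* On this smaller ball [u0 t] stays in the domain of the local inverse [h], so that
   [h (u0 t) = t]. *)
move=> /nbhs_ballP[r2 /= r20 Hr2].
have [|s|r3 [r30 r32 half]] := @implicit_arg_contraction (ball t0 r2) t0 psi _ (ballxx _ r20).
- exact: ball_open.
- by apply: smooth_subset (spsi s) => t /Hr2[/r1I].
have spsi3 s : smooth_on (ball t0 r3) (psi s).
  by apply: smooth_subset (spsi s) => t /r32/Hr2[/r1I].
(* The hyperplanes sweep out a neighbourhood: [x] lies on the one attached to [t] exactly when [t]
   solves this equation. *)
have Ex : \forall x \near p, ball p rho x /\
    exists t, ball t0 r3 t /\ t = implicit_arg psi t x.
  near=> x; split; first by near: x; exact: nbhsx_ballx.
  near: x; apply: (@implicit_exists R _ m (ball p r3) t0 r3 psi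
    (fun x => x 0 ord_max) (fun s x => x 0 (widen_ord (leqnSn m) s))
    spsi3 _ (ball_open _ _) r30 _ _ p (ballxx _ r30)).
  - exact: half.
  - by apply: smooth_coord; exact: ball_open.
  - by move=> s; apply: smooth_coord; exact: ball_open.
  - exact/esym/implicit_arg_axis.
pose V := [set x | ball p rho x /\
    exists t, ball t0 r3 t /\ t = implicit_arg psi t x]°.
(* The coefficients are reparametrised by the value of [f] instead of the position on the axis. *)
pose Psi s := psi s \o h.
have key x : V x -> exists t, [/\ ball t0 r2 t, f x = u0 t & implicit_arg Psi (f x) x = t].
  move=> /interior_subset[Bx [t [/r32 Bt Et]]].
  have [B1 Jt] := Hr2 _ Bt; have It := r1I _ B1.
  have fx : f x = u0 t.
    (* Applied at the axis point of parameter [t]; the rest checks that the gradient there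
       annihilates the displacement to [x]. *)
    apply: (hyperplanar_tangent oU sf hf BU It Bx).
      by exists ord_max; exact/tf/IU.
    rewrite big_ord_recr /=.
    have d0 := du0 _ It; move: (d0); rewrite derive_axis; last first.
      exact/(smooth_differentiable sf)/IU.
    set dn := partial ord_max _ _ => dn0.
    have subE y i : (x - y) 0 i = x 0 i - y 0 i by rewrite !mxE.
    have xE : x 0 ord_max = t - \sum_(s < m) psi s t * x 0 (widen_ord (leqnSn m) s).
      by apply/eqP; rewrite eq_sym subr_eq; exact/eqP.
    rewrite subE axis_point_max xE.
    rewrite addrAC subrr add0r mulrN mulr_sumr -sumrB big1 // => s _.
    rewrite subE axis_point_widen subr0 /psi derive_axis; last first.
      exact/(smooth_differentiable sf)/IU.
    by rewrite -/dn; field.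
  exists t; split=> //; rewrite fx /implicit_arg {2}Et; congr (_ + _).
  by apply: eq_bigr => s _; rewrite /Psi /= hu.
exists V, I, J, u0, Psi; split.
- exact: open_interior.
- exact: Ex.
- by move=> x /interior_subset[/BU].
- split=> //.
  + move=> s k; apply: (@Ck_comp _ _ k J I (psi s) h oJ _ (spsi s k) (sh k)).
    by move=> c /hJ[/r1I].
  + by move=> s c /hJ[/r1I Ic _]; exact: psi0.
- split=> // x /key[t [/Hr2[Bt Jt] fx E]].
  + by rewrite fx.
  + by rewrite E; exact: r1I.
  + by rewrite E.
Unshelve. all: by end_near. Qed.
End Coordinates.

(** * Solutions of the implicit equation *)

Section LinearForms.
Variables (R : realType) (n : nat).
Implicit Types (U : set 'rV[R]_n) (a x v : 'rV[R]_n).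

Fact dot_linear a : linear (dot a : 'rV[R]_n -> R).
Proof. by move=> t x y; rewrite dotD dotZ. Qed.

HB.instance Definition _ a :=
  GRing.isLinear.Build R 'rV[R]_n R _ (dot a) (dot_linear a).

Lemma smooth_dot U a : open U -> smooth_on U (dot a).
Proof.
move=> oU k; apply: Ck_sum => // i; apply: CkM => //; first exact: Ck_cst.
exact: smooth_coord.
Qed.

Lemma dot_continuous a : continuous (dot a).
Proof. by move=> x; exact: (@smooth_dot setT a openT 0%N x). Qed.

Lemma derive_dot a x v : 'D_v (dot a) x = dot a v.
Proof.
have c : continuous (dot a) by exact: dot_continuous.
by rewrite deriveE ?diff_lin //; exact: linear_differentiable.
Qed.

Lemma dot_delta a i : dot a (delta_mx 0 i) = a 0 i.
Proof.
rewrite /dot (bigD1 i) //= big1 => [|j ji]; first by rewrite mxE !eqxx mulr1 addr0.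
by rewrite mxE eqxx (negbTE ji) mulr0.
Qed.

End LinearForms.

Lemma det_continuous_at (R : realType) (V : normedModType R) n (M : V -> 'M[R]_n) p :
  (forall i j, {for p, continuous (fun x => M x i j)}) ->
  {for p, continuous (fun x => \det (M x))}.
Proof.
move=> cM; apply: cvg_big => [|s _]; first exact: add_continuous.
apply: cvgM; first exact: cvg_cst.
apply: cvg_big => [|i _]; first exact: mul_continuous.
exact: cM.
Qed.

(** * Covectors in general position, one of them prescribed *)

Section GeneralPosition.
Variables (R : realType) (m d : nat) (w : 'rV[R]_m.+1).
Hypothesis w0 : w 0 0 != 0.

(** A change of frame sending the first basis covector to [w]; it is upper triangular, hence
    invertible because [w 0 0] is nonzero. *)
Let g : 'M[R]_m.+1 := \matrix_(i, k) if i == 0 then w 0 k else (i == k)%:R.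

(** Points of the moment curve at integer parameters, moved by [g] so that the parameter 0 gives
    [w]. *)
Definition moment_covector (j : nat) : 'rV[R]_m.+1 :=
  (\row_i j%:R ^+ i) *m g.

Lemma moment_frame_unit : g \in unitmx.
Proof.
rewrite unitmxE unitfE -det_tr det_trig.
  apply/prodf_neq0 => i _; rewrite !mxE eqxx; case: ifP => [/eqP -> //|_].
  exact: oner_neq0.
apply/is_trig_mxP => i j ij; rewrite !mxE.
have j0 : (j == 0) = false by apply/negbTE; rewrite -lt0n (leq_trans _ ij).
by rewrite j0 -val_eqE /= gtn_eqF.
Qed.

Lemma moment_covector0 : moment_covector 0 = w.
Proof.
(* With [0 ^+ 0 = 1], the parameter 0 selects the first row of [g]. *)
apply/rowP => k; rewrite !mxE (bigD1 0) //= big1 ?addr0.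
  by rewrite !mxE eqxx expr0 mul1r.
by move=> i i0; rewrite !mxE expr0n; rewrite -val_eqE /= in i0; rewrite (negbTE i0) mul0r.
Qed.

Lemma moment_covector_neq0 j : moment_covector j != 0.
Proof.
apply/eqP => /(congr1 (fun v => v *m invmx g)).
(* Undoing [g] exposes the leading entry [j%:R ^+ 0 = 1]. *)
rewrite mulmxK ?moment_frame_unit // mul0mx => /rowP/(_ 0).
by rewrite !mxE expr0 => /eqP; rewrite oner_eq0.
Qed.

(** The matrix is a transposed Vandermonde matrix times [g]; its nodes are distinct since naturals
    embed injectively in [R]. *)
Lemma moment_covector_unit (s : 'I_m.+1 -> 'I_d) : injective s ->
  \matrix_(i, k) moment_covector (s i) 0 k \in unitmx.
Proof.
move=> sI.
have -> : \matrix_(i, k) moment_covector (s i) 0 k =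
    (Vandermonde m.+1 (\row_i (s i)%:R))^T *m g.
  apply/matrixP => i k; rewrite !mxE; apply: eq_bigr => l _.
  by rewrite !mxE.
rewrite unitmx_mul moment_frame_unit andbT unitmx_tr unitmxE unitfE det_Vandermonde.
apply/prodf_neq0 => i _; apply/prodf_neq0 => j ij.
rewrite !mxE subr_eq0 eqr_nat; apply: contraTneq ij => /ord_inj/sI ->.
by rewrite ltnn.
Qed.
End GeneralPosition.

(** The default value 1 of [oapp] is the coefficient of x_n, the index where [unlift ord_max]
    fails. *)
Definition normal_covector (R : realType) (m : nat) (Psi : 'I_m -> R -> R) (c : R)
  : 'rV[R]_m.+1 := \row_i oapp (Psi^~ c) 1 (unlift ord_max i).

Lemma implicit_arg_dot (R : realType) (m : nat) (Psi : 'I_m -> R -> R) c x :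
  implicit_arg Psi c x = dot (normal_covector Psi c) x.
Proof.
rewrite /dot big_ord_recr /= mxE unlift_none /= mul1r addrC; congr (_ + _).
apply: eq_bigr => s _; rewrite mxE.
have -> : widen_ord (leqnSn m) s = lift ord_max s.
  by apply: val_inj; rewrite /= /bump leqNgt ltn_ord.
by rewrite liftK.
Qed.

Lemma normal_covector_neq0 (R : realType) (m : nat) (Psi : 'I_m -> R -> R) c i :
  (forall s, Psi s c != 0) -> normal_covector Psi c 0 i != 0.
Proof.
by move=> Pc; rewrite mxE; case: unlift => [s|] /=; [exact: Pc|exact: oner_neq0].
Qed.

(** * From the normal form to a hyperplanar web *)

Section NormalForm.
Variables (R : realType) (m : nat) (t0 : R) (I J : set R) (u0 : R -> R).
Variable Psi : 'I_m -> R -> R.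
Hypothesis data : admissible_data t0 I J u0 Psi.

Let p : 'rV[R]_m.+1 := axis_point m t0.
Let phi s := Psi s \o u0.

(* The last clause makes t |-> implicit_arg phi t x a contraction. *)
Lemma normal_form_radius : exists r, [/\ 0 < r,
  forall t, ball t0 r t -> I t /\ J (u0 t),
  forall a b, ball t0 r a -> ball t0 r b -> u0 a = u0 b -> a = b,
  forall s, smooth_on (ball t0 r) (phi s) &
  forall x t, ball p r x -> ball t0 r t ->
    `|\sum_(s < m) 'D_1 (phi s) t * x 0 (widen_ord (leqnSn m) s)| <= 2^-1].
Proof.
have [oI oJ It0 Jt0 su0 du0 sPsi Psi0] := data.
have [r1 [J1 [h [r10 r1I [oJ1 J1c] _ [_ hu]]]]] :=
  smooth_inverse oI It0 su0 (du0 _ It0).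
have : \forall t \near t0, ball t0 r1 t /\ (J1 `&` J) (u0 t).
  near=> t; split; first by near: t; exact: nbhsx_ballx.
  near: t; apply: (smooth_continuous su0 It0).
  by apply: open_nbhs_nbhs; split=> //; exact: openI.
move=> /nbhs_ballP[r2 /= r20 Hr2].
have sphi s : smooth_on (ball t0 r2) (phi s).
  move=> k; apply: (@Ck_comp _ _ k _ J) => //; first exact: ball_open.
  - by move=> t /Hr2[_ []].
  - exact: sPsi.
  - by apply: (smooth_subset _ su0) => t /Hr2[/r1I].
have [|r3 [r30 r32 half]] :=
  @implicit_arg_contraction R m (ball t0 r2) t0 phi _ (ballxx _ r20) sphi.
  exact: ball_open.
exists r3; split=> //.
- by move=> t /r32/Hr2[/r1I It [_ Jt]].
- move=> a b /r32/Hr2[Ba [Ja _]] /r32/Hr2[Bb [Jb _]] ab.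
  by rewrite -(hu _ Ba Ja) -(hu _ Bb Jb) ab.
- by move=> s; apply: (smooth_subset r32).
Unshelve. all: by end_near. Qed.

(** Solving for the argument [T] of [u0] first puts the equation in contractive form with
    [phi s = Psi s \o u0]; then [u0 \o T] is the solution. *)
Lemma normal_form_solution : exists (V : set 'rV[R]_m.+1) (f : 'rV[R]_m.+1 -> R),
  [/\ open V, V p, smooth_on V f & solves_implicit_equation V I J u0 Psi f].
Proof.
have [oI oJ It0 Jt0 su0 du0 sPsi Psi0] := data.
have [r [r0 rIJ _ sphi half]] := normal_form_radius.
have oB : open (ball p r) by exact: ball_open.
have [|W [T [oW Wp WB sT HT]]] := @implicit_function R _ m (ball p r) t0 r phi
    (fun x => x 0 ord_max) (fun s x => x 0 (widen_ord (leqnSn m) s))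
    sphi half oB r0 (smooth_coord _ oB) (fun s => smooth_coord _ oB) p (ballxx _ r0).
  exact/esym/implicit_arg_axis.
have argT x : W x -> implicit_arg Psi (u0 (T x)) x = T x.
  by move=> /HT[_ {2}->].
exists W, (u0 \o T); split=> //.
  move=> k; apply: (@Ck_comp _ _ k W I u0 T oW _ (su0 k) (sT k)).
  by move=> x /HT[/rIJ[]].
split=> [x Wx|x Wx|x Wx|t Wt] /=.
- by have [/rIJ[]] := HT _ Wx.
- by rewrite argT //; have [/rIJ[]] := HT _ Wx.
- by rewrite argT.
- by congr u0; rewrite -argT // implicit_arg_axis.
Qed.

Variables (V : set 'rV[R]_m.+1) (f : 'rV[R]_m.+1 -> R).
Hypothesis oV : open V.
Hypothesis Vp : V p.
Hypothesis sf : smooth_on V f.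
Hypothesis sol : solves_implicit_equation V I J u0 Psi f.

(** For a given solution the parameter is read off from [f]; on [V] it satisfies [f = u0 \o T]. *)
Let T x := implicit_arg Psi (f x) x.

Lemma smooth_implicit_arg : smooth_on V T.
Proof.
move=> k; apply: CkD => //; first exact: smooth_coord.
apply: Ck_sum => // s; apply: CkM => //; last exact: smooth_coord.
by apply: (@Ck_comp _ _ k V J (Psi s) f oV (sol_J sol) (data_smooth_Psi data s k) (sf k)).
Qed.

(** Where the i-th partial of [f] vanishes, the coefficients [Psi s (f x)] are stationary in that
    direction and only the explicit linear dependence on [x] contributes. *)
Lemma partial_implicit_arg x i : V x -> partial i f x = 0 ->
  partial i T x = implicit_arg Psi (f x) (delta_mx 0 i).
Proof.
move=> Vx fi0; set v : 'rV[R]_m.+1 := delta_mx 0 i.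
have dcoord j : derivable (fun y : 'rV[R]_m.+1 => y 0 j) x v.
  exact/diff_derivable/(smooth_differentiable (smooth_coord j oV)).
have df := smooth_differentiable sf Vx.
have dP s := smooth_differentiable (data_smooth_Psi data s) (sol_J sol Vx).
have dPf s : derivable (Psi s \o f) x v.
  by apply: diff_derivable; exact: differentiable_comp.
pose term s (y : 'rV[R]_m.+1) := (Psi s \o f) y * y 0 (widen_ord (leqnSn m) s).
have dterm s : derivable (term s) x v by exact: derivableM.
have -> : T = (fun y : 'rV[R]_m.+1 => y 0 ord_max) + \sum_(s < m) term s.
  by apply/funext => y; rewrite !fctE fct_sumE.
rewrite /partial -/v deriveD //; last exact: derivable_sum.
rewrite derive_sum // derive_coord; congr (_ + _); apply: eq_bigr => s _.
rewrite /term deriveM // derive_comp // [X in _ * X](_ : _ = 0); last exact: fi0.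
by rewrite mulr0 scaler0 addr0 derive_coord.
Qed.

(** If the partial vanished, [f = u0 \o T] with nonzero derivative of [u0] would force that of [T]
    to vanish as well; but the latter would be 1 or some [Psi s (f x)], which is nonzero. *)
Lemma partial_solution_neq0 x i : V x -> partial i f x != 0.
Proof.
move=> Vx; apply/eqP => fi0.
have Tx : I (T x) by exact: sol_I sol _ Vx.
have dT := smooth_differentiable smooth_implicit_arg Vx.
have du := smooth_differentiable (data_smooth_u0 data) Tx.
have : partial i f x = 'D_1 u0 (T x) * partial i T x.
  rewrite -derive_comp //; apply: near_eq_derive; near=> y.
  by apply: (sol_eq sol); near: y; exact: open_nbhs_nbhs.
rewrite fi0 partial_implicit_arg // => /esym/eqP.
rewrite mulf_eq0 (negbTE (data_du0 data Tx)) /=; apply/negP.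
rewrite implicit_arg_dot dot_delta; apply: normal_covector_neq0 => s.
exact: (data_Psi_neq0 data _ (sol_J sol Vx)).
Unshelve. all: by end_near. Qed.

(** Equal values give equal parameters by injectivity of [u0], so [y] lies on the hyperplane of [x].
    Conversely, on that hyperplane [T x] solves the fixed point equation at [y], as [T y] does, and
    uniqueness identifies them. *)
Lemma solution_level_set r :
  (forall a b, ball t0 r a -> ball t0 r b -> u0 a = u0 b -> a = b) ->
  (forall s, smooth_on (ball t0 r) (phi s)) ->
  (forall x t, ball p r x -> ball t0 r t ->
    `|\sum_(s < m) 'D_1 (phi s) t * x 0 (widen_ord (leqnSn m) s)| <= 2^-1) ->
  forall x y, V x -> V y -> ball p r y -> ball t0 r (T x) -> ball t0 r (T y) ->
  f y = f x <-> hyperplane (normal_covector Psi (f x)) (T x) y.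
Proof.
move=> inj sphi half x y Vx Vy By BTx BTy.
rewrite /hyperplane /= -/(dot _ _) -implicit_arg_dot.
have Ex := sol_eq sol Vx; have Ey := sol_eq sol Vy; split=> [fyx|H].
  by rewrite -fyx; apply: inj => //; rewrite -[LHS]Ey -[RHS]Ex.
suff : T y = T x by rewrite Ex Ey -/(T x) -/(T y) => ->.
apply: (@implicit_unique R _ m (ball p r) t0 r phi
    (fun x => x 0 ord_max) (fun s x => x 0 (widen_ord (leqnSn m) s))
    sphi half y) => //.
  by rewrite {1}/T [in LHS]Ey.
by rewrite -[LHS]H [in LHS]Ex.
Qed.

Lemma solution_hyperplanar_web d : (m.+2 <= d)%N ->
  exists W : set 'rV[R]_m.+1,
    [/\ W p, W `<=` V, hyperplanar_web_function d W f
      & transversal_to_coordinates W f].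
Proof.
move=> hd.
have [r [r0 _ inj sphi half]] := normal_form_radius.
pose w : 'rV[R]_m.+1 := \row_i partial i f p.
have w0 : w 0 0 != 0 by rewrite mxE partial_solution_neq0.
(* Foliation 0 is given by [f], the others are parallel hyperplanes; by the choice of [w], all
   gradients at [p] are moment covectors. *)
pose F (a : 'I_d) := if val a == 0%N then f else dot (moment_covector w a).
have sF a : smooth_on V (F a).
  by rewrite /F; case: ifP => _ //; exact: smooth_dot.
have Fp a k : partial k (F a) p = moment_covector w a 0 k.
  rewrite /F; have [->|_] := eqVneq (val a) 0%N.
    by rewrite moment_covector0 mxE.
  by rewrite /partial derive_dot dot_delta.
(* General position at [p] spreads to a neighbourhood by continuity of the determinant. Selections
   are finite functions, so finitely many neighbourhoods are intersected afterwards. *)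
have gp (s : {ffun 'I_m.+1 -> 'I_d}) : \forall x \near p, injective s ->
    \matrix_(i, j) partial j (F (s i)) x \in unitmx.
  have [sI|nsI] := pselect (injective s); last by near=> x => /nsI.
  have c : {for p, continuous (fun x => \det (\matrix_(i, j) partial j (F (s i)) x))}.
    apply: det_continuous_at => i j.
    have -> : (fun x => (\matrix_(i, j) partial j (F (s i)) x) i j) = partial j (F (s i)).
      by apply/funext => x; rewrite mxE.
    exact: (smooth_continuous (smooth_derive (delta_mx 0 j) (sF (s i))) Vp).
  have Mp : \matrix_(i, j) partial j (F (s i)) p =
            \matrix_(i, j) moment_covector w (s i) 0 j.
    by apply/matrixP => i j; rewrite [LHS]mxE Fp [RHS]mxE.
  have detp : \det (\matrix_(i, j) partial j (F (s i)) p) != 0.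
    by rewrite -unitfE -unitmxE Mp; exact: moment_covector_unit.
  near=> x => _; rewrite unitmxE unitfE; near: x.
  exact: (cvgr_neq0 _ c detp).
have near_p : \forall x \near p, [/\ V x, ball p r x, ball t0 r (T x) &
    forall s : {ffun 'I_m.+1 -> 'I_d}, injective s ->
    \matrix_(i, j) partial j (F (s i)) x \in unitmx].
  near=> x; split; near: x.
  - exact: open_nbhs_nbhs.
  - exact: nbhsx_ballx.
  - apply: (smooth_continuous smooth_implicit_arg Vp).
    by rewrite /T implicit_arg_axis; exact: nbhsx_ballx.
  - exact: filter_forall.
have {near_p} /nbhs_ballP[rho /= rho0 HW] := near_p.
(* A ball, so that its intersections with hyperplanes are connected leaves. *)
pose W := ball p rho.
have oW : open W by exact: ball_open.
have WV : W `<=` V by move=> x /HW[].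
exists W; split=> //; first exact: ballxx.
- have d0 : (0 < d)%N by apply: leq_trans hd.
  exists F; split; last by exists (Ordinal d0); rewrite /F.
  split; first split=> // [a|x Wx s sI].
  + exact: smooth_subset (sF a).
  + have [_ _ _ /(_ (finfun s))] := HW _ Wx.
    have -> : \matrix_(i, j) partial j (F (finfun s i)) x =
              \matrix_(i, j) partial j (F (s i)) x.
      by apply/matrixP => i j; rewrite !mxE ffunE.
    by apply=> i j; rewrite !ffunE => /sI.
  + move=> a x Wx; rewrite /F; case: ifP => _.
      have [Vx _ BTx _] := HW _ Wx.
      exists (normal_covector Psi (f x)), (T x), W; split=> //.
        apply/eqP => /rowP/(_ ord_max)/eqP; rewrite [X in _ == X]mxE; apply/negP.
        by apply: normal_covector_neq0 => s; exact: (data_Psi_neq0 data _ (sol_J sol Vx)).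
      apply: (@leaf_level _ _ _ _ _ _ p rho) => // y /HW[Vy By BTy _].
      exact: (@solution_level_set r).
    exists (moment_covector w a), (dot (moment_covector w a) x), W; split=> //.
      exact: moment_covector_neq0.
    by apply: (@leaf_level _ _ _ _ _ _ p rho).
- by move=> x /WV Vx i; exact: partial_solution_neq0.
Unshelve. all: by end_near. Qed.

End NormalForm.

Unset Implicit Arguments.
Set Strict Implicit.

Theorem theorem8 (R : realType) (m d : nat) (hd : (m.+2 <= d)%N) (t0 : R) :
  (forall (U : set 'rV[R]_m.+1) (f : 'rV[R]_m.+1 -> R),
     U (axis_point m t0) ->
     hyperplanar_web_function d U f ->
     transversal_to_coordinates U f ->
     exists (V : set 'rV[R]_m.+1) (I J : set R) (u0 : R -> R)
            (Psi : 'I_m -> R -> R),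
       [/\ open V, V (axis_point m t0), V `<=` U,
           admissible_data t0 I J u0 Psi
         & solves_implicit_equation V I J u0 Psi f])
  /\
  (forall (I J : set R) (u0 : R -> R) (Psi : 'I_m -> R -> R),
     admissible_data t0 I J u0 Psi ->
     (exists (V : set 'rV[R]_m.+1) (f : 'rV[R]_m.+1 -> R),
        [/\ open V, V (axis_point m t0), smooth_on V f
          & solves_implicit_equation V I J u0 Psi f])
     /\
     (forall (V : set 'rV[R]_m.+1) (f : 'rV[R]_m.+1 -> R),
        open V -> V (axis_point m t0) -> smooth_on V f ->
        solves_implicit_equation V I J u0 Psi f ->
        exists W : set 'rV[R]_m.+1,
          [/\ W (axis_point m t0), W `<=` V,
              hyperplanar_web_function d W f
            & transversal_to_coordinates W f])).
Proof.
split=> [U f Up [F [[wF hF] [a <-]]] tf|I J u0 Psi data].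
  exact: (hyperplanar_normal_form (web_open wF) Up (web_smooth wF a) (hF a) tf).
split=> [|V f oV Vp sf sol]; first exact: normal_form_solution.
exact: (solution_hyperplanar_web data oV Vp sf sol hd).
Qed.
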